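(* Let $f:\mathcal X\times\Xi\to\mathbb R$ be a (possibly nonlinear) constraint function, where $x\in\mathcal X$ is the decision variable and $\xi\in\Xi$ is the uncertain variable, let $\alpha\ge 0$ be a risk level, and let $\mathcal P=\{P:\operatorname{MMD}(P,\hat P_N)\le\varepsilon\}$ be the MMD ambiguity set of radius $\varepsilon$ centered at the empirical distribution $\hat P_N$ of the sample $\xi_1,\dots,\xi_N\in\Xi$. Then the feasible set $$Z=\Big\{x\in\mathcal X:\ \inf_{P\in\mathcal P}P\{f(x,\xi)\le 0\}\ge 1-\alpha\Big\}$$ equals the set of all $x\in\mathcal X$ for which there exist $g\in\mathcal H$ and $g_0\in\mathbb R$ such that $$g_0+\frac1N\sum_{i=1}^N g(\xi_i)+\varepsilon\|g\|_{\mathcal H}\le\alpha$$ and $$\mathbb 1\big(f(x,\xi)>0\big)\le g(\xi)+g_0\qquad\text{for all }\xi\in\Xi .$$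
   Context: $\mathcal X\subset\mathbb R^n$ and $\Xi\subseteq\mathbb R^m$; $\xi$ is a random variable with values in $\Xi$. $k:\Xi\times\Xi\to\mathbb R$ is a symmetric positive definite kernel (i.e. $\sum_{i,j}a_ia_jk(x_i,x_j)\ge0$ for all finite families of points $x_i$ and reals $a_i$), with associated reproducing kernel Hilbert space $\mathcal H$ of functions on $\Xi$ and norm $\|\cdot\|_{\mathcal H}$. For a probability distribution $P$ on $\Xi$, its kernel mean embedding is $\mu_P=\int k(\xi,\cdot)\,dP(\xi)\in\mathcal H$, and the maximum mean discrepancy is $\operatorname{MMD}(P,Q)=\|\mu_P-\mu_Q\|_{\mathcal H}$. The empirical distribution is $\hat P_N=\frac1N\sum_{i=1}^N\delta_{\xi_i}$. The ambiguity set $\mathcal P$ consists of probability distributions on $\Xi$ within MMD distance $\varepsilon>0$ of $\hat P_N$. $\mathbb 1(\cdot)$ denotes the indicator function (1 if the condition holds, 0 otherwise). *)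

(* Defs.v *)
From HB Require Import structures.
From mathcomp Require Import all_boot all_order all_algebra.
From mathcomp Require Import all_classical all_reals all_analysis.

Set Implicit Arguments.
Unset Strict Implicit.
Unset Printing Implicit Defensive.

Import Order.TTheory GRing.Theory Num.Theory.
Import numFieldNormedType.Exports.

Local Open Scope classical_set_scope.
Local Open Scope ring_scope.

(* The library's measurable types are pointed, so a subset is carried together
   with a witness [x0] that it is nonempty; [x0] plays no other role. *)
Definition pointed_sub (T : Type) (A : set T) (x0 : A) : Type := set_type A.

HB.instance Definition _ (T : topologicalType) (A : set T) (x0 : A) :=
  Topological.on (pointed_sub x0).
HB.instance Definition _ (T : topologicalType) (A : set T) (x0 : A) :=
  isPointed.Build (pointed_sub x0) x0.

(* [A] with the Borel sigma-algebra of its subspace topology. *)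
Definition borel_sub (T : topologicalType) (A : set T) (x0 : A) :=
  g_sigma_algebraType (@open (pointed_sub x0)).

HB.instance Definition _ (T : topologicalType) (A : set T) (x0 : A) :=
  Measurable.on (borel_sub x0).

Definition psd_kernel (R : realType) (T : Type) (k : T -> T -> R) :=
  (forall x y, k x y = k y x) /\
  forall (p : nat) (x : 'I_p -> T) (a : 'I_p -> R),
    0 <= \sum_(i < p) \sum_(j < p) a i * a j * k (x i) (x j).

(* A Hilbert space of functions on [T] with reproducing kernel [k].  An element
   [g] is identified with the function [rkhs_eval g], which determines it. *)
Record rkhs (R : realType) (T : Type) (k : T -> T -> R) := Rkhs {
  rkhs_space :> completeNormedModType R;
  rkhs_dot : {dot rkhs_space for idfun};
  rkhs_normE : forall g : rkhs_space, `|g| ^+ 2 = rkhs_dot g g;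
  rkhs_eval : rkhs_space -> T -> R;
  rkhs_eval_linear : forall (a : R) (g h : rkhs_space) (x : T),
    rkhs_eval (a *: g + h) x = a * rkhs_eval g x + rkhs_eval h x;
  rkhs_eval_inj : injective rkhs_eval;
  rkhs_feature : T -> rkhs_space;
  rkhs_featureE : forall x y, rkhs_eval (rkhs_feature x) y = k x y;
  rkhs_reproducing : forall (g : rkhs_space) (x : T),
    rkhs_eval g x = rkhs_dot g (rkhs_feature x)
}.

Arguments rkhs_dot {R T k} r.
Arguments rkhs_eval {R T k} r.
Arguments rkhs_feature {R T k} r.

Section MMD.
Context d (T : measurableType d) (R : realType) (k : T -> T -> R) (H : rkhs k).

(* [v] is the weak (Pettis) integral of [F] with respect to [mu].  By the Riesz
   representation theorem the functionals [rkhs_dot H h] are all the continuous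
   linear functionals on [H]. *)
Definition is_weak_integral (mu : {measure set T -> \bar R}) (F : T -> H)
    (v : H) :=
  forall h : H,
    mu.-integrable setT (fun t => (rkhs_dot H h (F t))%:E) /\
    rkhs_dot H h v = \int[mu]_t rkhs_dot H h (F t).

Definition has_mean_embedding (mu : {measure set T -> \bar R}) :=
  exists v : H, is_weak_integral mu (rkhs_feature H) v.

(* Only meaningful under [has_mean_embedding mu]; the weak integral is then
   unique since [rkhs_dot H] is definite. *)
Definition mean_embedding (mu : {measure set T -> \bar R}) : H :=
  xget 0 [set v : H | is_weak_integral mu (rkhs_feature H) v].

Definition mmd (mu nu : {measure set T -> \bar R}) : R :=
  `|mean_embedding mu - mean_embedding nu|.

Definition ambiguity_set (mu : {measure set T -> \bar R}) (eps : R) :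
    set (probability T R) :=
  [set P | has_mean_embedding P /\ mmd P mu <= eps].

End MMD.

Section empirical.
Local Open Scope ereal_scope.
Context d (T : measurableType d) (R : realType) (N : nat) (xi : 'I_N -> T).

Definition empirical (A : set T) : \bar R :=
  (N%:R^-1)%:E * \sum_(i < N) \d_(xi i) A.

Let empirical0 : empirical set0 = 0.
Proof. by rewrite /empirical big1 ?mule0// => i _; rewrite measure0. Qed.

Let empirical_ge0 A : 0 <= empirical A.
Proof.
apply: mule_ge0; first by rewrite lee_fin invr_ge0 ler0n.
by apply: sume_ge0 => i _.
Qed.

Let empirical_sigma_additive : semi_sigma_additive empirical.
Proof.
pose m (i : nat) : {measure set T -> \bar R} :=
  if insub i is Some j then dirac (xi j) else mzero.
have NE : (0 <= N%:R^-1 :> R)%R by rewrite invr_ge0 ler0n.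
have -> : empirical = mscale (NngNum NE) (msum m N).
  apply/funext => A; rewrite /empirical /mscale /msum /=; congr (_ * _).
  apply: eq_bigr => i _; rewrite /m.
  by case: insubP => [j _ /val_inj ->//|]; rewrite ltn_ord.
exact: measure_semi_sigma_additive.
Qed.

HB.instance Definition _ := isMeasure.Build _ _ _ empirical
  empirical0 empirical_ge0 empirical_sigma_additive.

Lemma empirical_setT : (0 < N)%N -> empirical setT = 1.
Proof.
move=> N0; rewrite /empirical (eq_bigr (fun=> 1%:E)) => [|i _]; last first.
  by rewrite diracT.
by rewrite sumEFin sumr_const card_ord -EFinM mulVf// pnatr_eq0 -lt0n.
Qed.

End empirical.

Arguments empirical {d T} R {N} xi.

(* Main.v *)
Require Import Defs.
From HB Require Import structures.
From mathcomp Require Import all_boot all_order all_algebra.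
From mathcomp Require Import all_classical all_reals all_analysis.
From mathcomp Require Import measurable_realfun.
From mathcomp Require Import ring lra.

(** The statement is Lagrangian duality for the problem of maximising the
    violation probability [P (f > 0)] over the MMD ball, together with
    attainment of the dual optimum.

    Weak duality: if [g + g0] dominates the indicator of [f > 0], integrating
    against [P] gives [P (f > 0) <= <g, mu_P> + g0], and Cauchy-Schwarz bounds
    [<g, mu_P - mu_N>] by [eps * |g|], where [mu_N] is the embedding of the
    empirical distribution ([violation_le_majorant]).

    Strong duality: the pairs [(P (f > 0), mu_P - mu_N)], for [P] ranging over
    all the probabilities with a mean embedding, form a convex subset [E] of
    [R x H].  Robust feasibility says that [a <= alpha] for each [(a, v)] in
    [E] with [|v| <= eps].  The empirical distribution gives a point of [E]
    with [v = 0], which lies in the interior of the ball because [eps > 0]: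
    this is Slater's condition, and [lagrange_multiplier] then provides [g]
    with [a - <g, v> + eps * |g| <= alpha] on all of [E].  At the Dirac masses
    this inequality reads [1 (f t > 0) <= g t + g0] for
    [g0 = alpha - <g, mu_N> - eps * |g|], which is the dual certificate.

    The multiplier is constructed inside the Hilbert space, all the
    compactness coming from one consequence of the parallelogram identity: one
    can pick convergent points in a decreasing sequence of convex sets that
    meet a fixed ball ([cvg_nested_convex]).  It is used three times.
    Penalising the constraint [|v| <= eps] by the square of the distance to the
    ball makes the problem strictly concave in the residual, so that a
    maximising sequence converges and its limit is a multiplier up to an error
    [delta] ([penalized_multiplier], [approximate_multiplier]).  The multipliers
    with error [1 / (n + 1)] are nested, which gives an exact one in the limit.
    Finally, orthogonal projection on a closed subspace shows that every
    function of [H] is measurable when the kernel sections are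
    ([measurable_rkhs_eval]), so that Dirac masses, the empirical distribution
    and mixtures do have mean embeddings. *)

Set Implicit Arguments.
Unset Strict Implicit.
Unset Printing Implicit Defensive.

Import Order.TTheory GRing.Theory Num.Theory.
Import numFieldNormedType.Exports.

Local Open Scope classical_set_scope.
Local Open Scope ring_scope.

(** * Hilbert space geometry *)

Lemma invSn_le (R : realType) (e : R) : 0 < e ->
  exists N : nat, forall n, (N <= n)%N -> n.+1%:R^-1 < e.
Proof.
move=> e0; have /cvgrPdist_lt/(_ e e0)[N _ NP] := @cvg_harmonic R.
by exists N => n /NP /=; rewrite sub0r normrN ger0_norm.
Qed.

Lemma invSn_anti (R : realType) (n p : nat) : (n <= p)%N ->
  p.+1%:R^-1 <= n.+1%:R^-1 :> R.
Proof. by move=> np; rewrite lef_pV2 ?posrE// ler_nat ltnS. Qed.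

Lemma invSn_le1 (R : realType) (n : nat) : n.+1%:R^-1 <= 1 :> R.
Proof. by rewrite invf_le1// ler1n. Qed.

(** Directional derivatives enter only through this comparison: a first-order
    inequality that holds up to a multiple of the step holds exactly. *)
Lemma le_of_scaled_gap (R : realType) (x y z : R) : 0 <= z ->
  (forall t, 0 < t <= 1 -> x - t * z <= y) -> x <= y.
Proof.
move=> z0 h; apply/ler_addgt0Pr => e e0.
have ze : 0 < z + e by rewrite ltr_wpDl.
have := h (e / (z + e)); rewrite divr_gt0//= ler_pdivrMr// mul1r lerDr z0.
move=> /(_ isT); suff : e / (z + e) * z <= e by lra.
by rewrite mulrAC ler_pdivrMr// ler_wpM2l ?ltW// ltrDl.
Qed.

Section hilbert.
Context (R : realType) (V : completeNormedModType R) (dot : {dot V for idfun}).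
Hypothesis normE : forall g : V, `|g| ^+ 2 = dot g g.

Lemma dotC (u v : V) : dot u v = dot v u.
Proof. by rewrite hermC expr0 mul1r. Qed.

Lemma dotZl a (u v : V) : dot (a *: u) v = a * dot u v.
Proof. by rewrite linearZl_LR. Qed.

Lemma dotZr a (u v : V) : dot u (a *: v) = a * dot u v.
Proof. by rewrite dotC dotZl dotC. Qed.

Lemma dotDl (u v w : V) : dot (u + v) w = dot u w + dot v w.
Proof. exact: linearDl. Qed.

Lemma dotDr (u v w : V) : dot u (v + w) = dot u v + dot u w.
Proof. by rewrite dotC dotDl !(dotC u). Qed.

Lemma dotNl (u v : V) : dot (- u) v = - dot u v.
Proof. by rewrite -scaleN1r dotZl mulN1r. Qed.

Lemma dotNr (u v : V) : dot u (- v) = - dot u v.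
Proof. by rewrite dotC dotNl dotC. Qed.

Lemma dotBl (u v w : V) : dot (u - v) w = dot u w - dot v w.
Proof. by rewrite dotDl dotNl. Qed.

Lemma dotBr (u v w : V) : dot u (v - w) = dot u v - dot u w.
Proof. by rewrite dotDr dotNr. Qed.

Lemma dot0l (v : V) : dot 0 v = 0.
Proof. by rewrite -(scale0r 0) dotZl mul0r. Qed.

Lemma dot_sumr (I : Type) (r : seq I) (P : pred I) (F : I -> V) (u : V) :
  dot u (\sum_(i <- r | P i) F i) = \sum_(i <- r | P i) dot u (F i).
Proof. by apply: (big_morph (dot u) (dotDr u)); rewrite dotC dot0l. Qed.

Lemma sqr_normD (u v : V) : `|u + v| ^+ 2 = `|u| ^+ 2 + 2 * dot u v + `|v| ^+ 2.
Proof. rewrite !normE dotDl !dotDr (dotC v u); ring. Qed.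

Lemma sqr_normZ a (u : V) : `|a *: u| ^+ 2 = a ^+ 2 * `|u| ^+ 2.
Proof. by rewrite !normE dotZl dotZr mulrA expr2. Qed.

Lemma sqr_normB (u v : V) : `|u - v| ^+ 2 = `|u| ^+ 2 - 2 * dot u v + `|v| ^+ 2.
Proof. by rewrite sqr_normD dotNr normrN mulrN. Qed.

(** Strong convexity of the squared norm; at [t = 1/2] it is the parallelogram
    identity. *)
Lemma sqr_norm_conv t (u v : V) : `|(1 - t) *: u + t *: v| ^+ 2 =
  (1 - t) * `|u| ^+ 2 + t * `|v| ^+ 2 - t * (1 - t) * `|u - v| ^+ 2.
Proof. rewrite sqr_normB sqr_normD !sqr_normZ dotZl dotZr; ring. Qed.

Lemma half_conv (u v : V) :
  2^-1 *: u + 2^-1 *: v = (1 - 2^-1) *: u + 2^-1 *: v.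
Proof. by congr (_ *: _ + _); field. Qed.

(** Expand the square of the norm of [|v| u - |u| v]. *)
Lemma cauchy_schwarz (u v : V) : dot u v <= `|u| * `|v|.
Proof.
have [->|v0] := eqVneq v 0; first by rewrite dotC dot0l normr0 mulr0.
have [->|u0] := eqVneq u 0; first by rewrite dot0l normr0 mul0r.
have u1 : 0 < `|u| by rewrite normr_gt0.
have v1 : 0 < `|v| by rewrite normr_gt0.
have : 0 <= `| `|v| *: u - `|u| *: v| ^+ 2 by rewrite sqr_ge0.
rewrite sqr_normB !sqr_normZ dotZl dotZr => h.
have : 0 <= (`|u| * `|v|) * (`|u| * `|v| - dot u v) by nra.
by rewrite pmulr_rge0 ?mulr_gt0// subr_ge0.
Qed.

Lemma normr_dot_le (u v : V) : `|dot u v| <= `|u| * `|v|.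
Proof.
rewrite ler_norml cauchy_schwarz andbT lerNl -dotNl -(normrN u).
exact: cauchy_schwarz.
Qed.

Lemma cvg_dot (u : nat -> V) (l v : V) :
  u @ \oo --> l -> dot (u n) v @[n --> \oo] --> dot l v.
Proof.
move=> ul; apply/cvgrPdist_le => e e0.
have v1 : 0 < `|v| + 1 by rewrite ltr_wpDl.
move/cvgrPdist_le : ul => /(_ (e / (`|v| + 1)) (divr_gt0 e0 v1)).
apply: filterS => n; rewrite ler_pdivlMr// => h.
rewrite -dotBl (le_trans (normr_dot_le _ _))// (le_trans _ h)//.
by rewrite ler_wpM2l// lerDl.
Qed.

(** Elements [u n] of [C n] of almost minimal norm form a Cauchy sequence: for
    [n <= p] the midpoint of [u n] and [u p] is in [C n], so that its squared
    norm is at least the infimum [d n] of the squared norm over [C n], and the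
    parallelogram identity bounds the distance of [u n] to [u p] in terms of
    [d p - d n].  The sequence [d] is nondecreasing and bounded by [B ^+ 2].
    This replaces weak compactness. *)
Lemma cvg_nested_convex (C : nat -> set V) (B : R) :
    (forall n p, (n <= p)%N -> C p `<=` C n) ->
    (forall n u v, C n u -> C n v -> C n (2^-1 *: u + 2^-1 *: v)) ->
    (forall n, exists2 v, C n v & `|v| <= B) ->
  exists (u : nat -> V) (l : V), (forall n, C n (u n)) /\ u @ \oo --> l.
Proof.
move=> Cdecr Cmid CB.
pose S n := [set `|v| ^+ 2 | v in C n]; pose d n := inf (S n).
have S0 n : S n !=set0 by have [v Cv _] := CB n; exists (`|v| ^+ 2), v.
have Slb n : has_lbound (S n) by exists 0 => _ [v _ <-]; exact: sqr_ge0.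
have dle n v : C n v -> d n <= `|v| ^+ 2.
  by move=> Cv; apply: ge_inf => //; exists v.
have dmono n p : (n <= p)%N -> d n <= d p.
  move=> np; apply: lb_le_inf => // _ [v Cv <-]; apply: dle; exact: Cdecr Cv.
have dB n : d n <= B ^+ 2.
  have [v Cv vB] := CB n; rewrite (le_trans (dle _ _ Cv))//.
  by rewrite lerXn2r// nnegrE// (le_trans _ vB).
have [u uP] : {u : nat -> V & forall n, C n (u n) /\
    `|u n| ^+ 2 < d n + n.+1%:R^-1}.
  pose almost_min n v := C n v /\ `|v| ^+ 2 < d n + n.+1%:R^-1.
  apply: (@choice nat V almost_min) => n.
  have n0 : (0 : R) < n.+1%:R^-1 by rewrite invr_gt0.
  by have [_ [v Cv <-] vd] := inf_adherent n0 (conj (S0 n) (Slb n)); exists v.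
pose D := sup (range d).
have Dsup : has_sup (range d).
  by split; [exists (d 0%N), 0%N | exists (B ^+ 2) => _ [n _ <-]].
have dD n : d n <= D by apply: (ub_le_sup Dsup.2); exists n.
have near_far n p : (n <= p)%N ->
    `|u n - u p| ^+ 2 <= 2 * (D - d n) + 4 * n.+1%:R^-1.
  move=> np; have [Cn un] := uP n; have [Cp up] := uP p.
  have := dle n _ (Cmid _ _ _ Cn (Cdecr _ _ np _ Cp)).
  rewrite half_conv sqr_norm_conv.
  have := dD p; have := invSn_anti R np.
  move: un up; move: (n.+1%:R^-1 : R) (p.+1%:R^-1 : R) => en ep.
  move: (`|u n - u p| ^+ 2 : R) (`|u n| ^+ 2 : R) (`|u p| ^+ 2 : R) => X a b.
  by lra.
exists u, (lim (u @ \oo)); split; first by move=> n; exact: (uP n).1.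
apply: cauchy_cvg; apply: cauchy_exP => e e0.
have e2 : 0 < e ^+ 2 / 8 by rewrite divr_gt0// exprn_gt0.
have [_ [n _ <-] nD] := sup_adherent e2 Dsup.
have [m mP] := invSn_le e2.
pose k := maxn n m; exists (u k); exists k => // p /= kp.
rewrite -ball_normE /ball_/=.
rewrite -(@ltr_pXn2r _ 2) ?nnegrE// ?ltW//.
apply: (le_lt_trans (near_far _ _ kp)).
have := mP k (leq_maxr _ _); have := dmono n k (leq_maxl _ _).
move: nD; rewrite -/D; move: (k.+1%:R^-1 : R) (D : R) => ek D'; lra.
Qed.

(** The projection theorem, in the form of a density criterion: the residual of
    minimal norm in [h - M] is orthogonal to [M], hence zero. *)
Lemma closed_subspace_full (M : set V) :
    M 0 -> (forall a u v, M u -> M v -> M (a *: u + v)) ->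
    (forall (u : nat -> V) l, (forall n, M (u n)) -> u @ \oo --> l -> M l) ->
    (forall w, (forall v, M v -> dot w v = 0) -> w = 0) ->
  forall h, M h.
Proof.
move=> M0 Mlin Mcl Morth h.
have MD u v : M u -> M v -> M (u + v).
  by move=> Mu Mv; rewrite -(scale1r u); exact: Mlin.
have MZ a u : M u -> M (a *: u).
  by move=> Mu; rewrite -(addr0 (_ *: _)); exact: Mlin.
pose S := [set `|w| ^+ 2 | w in [set w | M (h - w)]]; pose d := inf S.
have Slb : has_lbound S by exists 0 => _ [v _ <-]; exact: sqr_ge0.
have S0 : S !=set0 by exists (`|h| ^+ 2), h => //=; rewrite subrr.
have dle w : M (h - w) -> d <= `|w| ^+ 2.
  by move=> Mw; apply: ge_inf => //; exists w.
pose C n := [set w | M (h - w) /\ `|w| ^+ 2 <= d + n.+1%:R^-1].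
have [w [l [wC wl]]] : exists (w : nat -> V) (l : V),
    (forall n, C n (w n)) /\ w @ \oo --> l.
  apply: (@cvg_nested_convex C (d + 2)).
  - move=> n p np w [Mw wd]; split => //; apply: (le_trans wd).
    by rewrite lerD2l invSn_anti.
  - move=> n u v [Mu ud] [Mv vd]; split.
      rewrite (_ : h - _ = 2^-1 *: (h - u) + 2^-1 *: (h - v)).
        by apply: Mlin => //; exact: MZ.
      rewrite !scalerBr addrACA -scalerDl opprD.
      by rewrite (_ : 2^-1 + 2^-1 = 1 :> R) ?scale1r//; field.
    rewrite half_conv sqr_norm_conv; have := sqr_ge0 (`|u - v| : R).
    move: ud vd.
    move: (`|u - v| ^+ 2 : R) (`|u| ^+ 2 : R) (`|v| ^+ 2 : R) => x a b.
    by move: (n.+1%:R^-1 : R) => en; lra.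
  - move=> n; have n0 : (0 : R) < n.+1%:R^-1 by rewrite invr_gt0.
    have [_ [v Cv <-] vd] := inf_adherent n0 (conj S0 Slb).
    exists v; first by split => //; exact: ltW.
    have := invSn_le1 R n; have := sqr_ge0 (`|v| - 1 : R).
    by move: vd; rewrite -/d; move: (n.+1%:R^-1 : R) (`|v| : R) => en a; nra.
have Ml : M (h - l).
  apply: (Mcl (fun n => h - w n)); first by move=> n; case: (wC n).
  exact: cvgB (cvg_cst _) wl.
have ld : `|l| ^+ 2 <= d.
  have w2 : `|w n| ^+ 2 @[n --> \oo] --> `|l| ^+ 2.
    rewrite expr2; under eq_fun do rewrite expr2.
    by apply: cvgM; exact: cvg_norm.
  apply: (ler_cvg_to w2 (_ : (d + n.+1%:R^-1) @[n --> \oo] --> d)).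
    rewrite -[X in _ --> X]addr0.
    by apply: cvgD; [exact: cvg_cst|exact: cvg_harmonic].
  by apply: nearW => n; case: (wC n).
suff l0 : l = 0 by move: Ml; rewrite l0 subr0.
apply: Morth => v Mv.
have key t : 0 <= - 2 * t * dot l v + t ^+ 2 * `|v| ^+ 2.
  have : M (h - (l - t *: v)).
    by rewrite opprB addrCA; apply: MD => //; exact: MZ.
  move/dle/(le_trans ld); rewrite sqr_normB sqr_normZ dotZr; lra.
have v1 : 0 < `|v| ^+ 2 + 1 by rewrite ltr_wpDl// sqr_ge0.
(* The minimising step would be [dot l v / `|v| ^+ 2]; the [+ 1] avoids the
   case [v = 0] and still gives a negative value unless [dot l v = 0]. *)
have := key (dot l v / (`|v| ^+ 2 + 1)).
set x := dot l v; set q := `|v| ^+ 2 in v1 *.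
rewrite (_ : _ + _ = - (x ^+ 2 * (q + 2)) / (q + 1) ^+ 2); last first.
  by field; rewrite gt_eqF.
rewrite mulNr oppr_ge0 => x2.
have q2 : 0 < (q + 2) / (q + 1) ^+ 2 by rewrite divr_gt0 ?exprn_gt0//; lra.
move: x2; rewrite -mulrA pmulr_lle0// => x2.
by apply/eqP; rewrite -sqrf_eq0 eq_le x2 sqr_ge0.
Qed.
End hilbert.

(** * Existence of Lagrange multipliers *)

Section duality.
Context (R : realType) (V : completeNormedModType R) (dot : {dot V for idfun}).
Hypothesis normE : forall g : V, `|g| ^+ 2 = dot g g.

(** The relation [F] stands for a subset of [R x V], in curried form. *)
Definition convex_rel (F : R -> V -> Prop) :=
  forall t a u b v, 0 <= t <= 1 -> F a u -> F b v ->
    F ((1 - t) * a + t * b) ((1 - t) *: u + t *: v).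

(** Maximise [a - c * |w| ^ 2] over [F].  Strict concavity in [w] makes the
    components [w] of a maximising sequence converge, to [l] say.  Moving from
    the sequence towards a point [(b, v)] of [F] cannot increase the limit value
    [M], and the first-order part of this inequality gives the conclusion, with
    [g = 2 c l]. *)
Lemma penalized_multiplier (F : R -> V -> Prop) (B U c : R) : 0 < c ->
    convex_rel F -> (exists a w, F a w) -> (forall a w, F a w -> a <= B) ->
    (forall a w, F a w -> a - c * `|w| ^+ 2 <= U) ->
  exists g, forall a w, F a w -> a - dot g w <= U.
Proof.
move=> c0 Fconv [a0 [w0 F0]] FB FU.
pose S := [set x | exists a w, F a w /\ x = a - c * `|w| ^+ 2].
have Ssup : has_sup S.
  split; first by exists (a0 - c * `|w0| ^+ 2), a0, w0.
  by exists U => _ [a [w [Faw ->]]]; exact: FU.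
pose M := sup S.
have MU : M <= U.
  by apply: ge_sup => [|_ [a [w [Faw ->]]]]; [case: Ssup|exact: FU].
have leM a w : F a w -> a - c * `|w| ^+ 2 <= M.
  by move=> Faw; apply: (ub_le_sup Ssup.2); exists a, w.
pose C n := [set w | exists a, F a w /\ M - n.+1%:R^-1 <= a - c * `|w| ^+ 2].
have [w [l [wC wl]]] : exists (w : nat -> V) (l : V),
    (forall n, C n (w n)) /\ w @ \oo --> l.
  apply: (@cvg_nested_convex _ _ _ normE C ((B - M + 1) / c + 1)).
  - move=> n p np w [a [Faw aw]]; exists a; split => //; apply: le_trans aw.
    by rewrite lerD2l lerN2 invSn_anti.
  - move=> n u v [a [Fau au]] [b [Fbv bv]].
    exists ((1 - 2^-1) * a + 2^-1 * b); rewrite half_conv; split.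
      by apply: Fconv => //; lra.
    rewrite (sqr_norm_conv normE).
    have : 0 <= c * (`|u - v| ^+ 2) by rewrite mulr_ge0 ?sqr_ge0// ltW.
    move: au bv; move: (`|u - v| ^+ 2 : R) (`|u| ^+ 2 : R) (`|v| ^+ 2 : R).
    by move: (n.+1%:R^-1 : R) (M : R) => en m x y z; lra.
  - move=> n; have n0 : (0 : R) < n.+1%:R^-1 by rewrite invr_gt0.
    have [_ [a [v [Fav ->]]] vd] := sup_adherent n0 Ssup.
    exists v; first by exists a; split => //; exact: ltW.
    have := invSn_le1 R n.
    have := FB _ _ Fav; move: vd; rewrite -/M.
    rewrite -lerBlDr ler_pdivlMr//; have := sqr_ge0 (`|v| - 1 : R).
    move: (n.+1%:R^-1 : R) (`|v| : R) (M : R) => en x m; nra.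
exists ((2 * c) *: l) => b v Fbv; apply: le_trans MU.
have -> : b - dot ((2 * c) *: l) v =
    b - c * `|v| ^+ 2 + c * `|l - v| ^+ 2 - c * `|l| ^+ 2.
  by rewrite (sqr_normB normE) dotZl; ring.
suff : b - c * `|v| ^+ 2 + c * `|l - v| ^+ 2 <= M.
  have : 0 <= c * (`|l| ^+ 2) by rewrite mulr_ge0 ?sqr_ge0// ltW.
  by move: (`|l| ^+ 2 : R) (`|l - v| ^+ 2 : R) (`|v| ^+ 2 : R) => x y z; lra.
apply: (@le_of_scaled_gap _ _ _ (c * `|l - v| ^+ 2)).
  by rewrite mulr_ge0 ?sqr_ge0// ltW.
move=> t /andP[t0 t1].
have lim1 :
    t * (b - c * `|v| ^+ 2 + (1 - t) * c * `|w n - v| ^+ 2 - M) @[n --> \oo]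
    --> t * (b - c * `|v| ^+ 2 + (1 - t) * c * `|l - v| ^+ 2 - M).
  apply: cvgM; first exact: cvg_cst.
  apply: cvgB; last exact: cvg_cst.
  apply: cvgD; first exact: cvg_cst.
  apply: cvgM; first exact: cvg_cst.
  have wv : `|w n - v| @[n --> \oo] --> `|l - v|.
    by apply: cvg_norm; apply: cvgB wl _; exact: cvg_cst.
  by rewrite expr2; under eq_fun do rewrite expr2; exact: (cvgM wv wv).
have := ler_cvg_to lim1 (@cvg_harmonic R); rewrite -subr_ge0 sub0r => lim2.
have : t * (b - c * `|v| ^+ 2 + (1 - t) * c * `|l - v| ^+ 2 - M) <= 0.
  rewrite -oppr_ge0; apply: lim2; apply: nearW => n.
  have [a [Faw aw]] := wC n.
  have := leM _ _ (Fconv t _ _ _ _ _ Faw Fbv); rewrite ltW//= t1 => /(_ isT).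
  rewrite (sqr_norm_conv normE) /harmonic /=.
  have : (0 : R) < n.+1%:R^-1 by rewrite invr_gt0.
  move: aw; move: (`|w n - v| ^+ 2 : R) (`|w n| ^+ 2 : R) (`|v| ^+ 2 : R).
  move: (n.+1%:R^-1 : R) (M : R) => en m x y z aw en0 h.
  have : (1 - t) * (m - en) <= (1 - t) * (a - c * y).
    by rewrite ler_wpM2l// subr_ge0.
  have : 0 <= t * en by rewrite mulr_ge0// ltW.
  lra.
rewrite pmulr_rle0//.
by move: (`|l - v| ^+ 2 : R) (`|v| ^+ 2 : R) (M : R) => x y z; lra.
Qed.

Section multiplier.
Variables (E : R -> V -> Prop) (a0 alpha eps : R).
Hypotheses (eps0 : 0 < eps) (Econv : convex_rel E).
Hypothesis E01 : forall a v, E a v -> 0 <= a <= 1.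
Hypothesis Ea0 : E a0 0.
Hypothesis Ealpha : forall a v, E a v -> `|v| <= eps -> a <= alpha.

(** Here [w = v - h] is the residual of [v] with respect to a point [h] of the
    ball.  With penalty [(|w| / (delta * eps)) ^ 2], a residual of norm at least
    [delta * eps] costs at least [1], the largest possible gain.  A smaller
    residual means [|v| <= (1 + delta) * eps], and then mixing with the Slater
    point [(a0, 0)] with weight [delta / (1 + delta)] brings [v] back into the
    ball, at a loss of at most [delta].  So the penalised value is at most
    [alpha + delta]; taking for [h] the point of the ball in the direction of
    [g] produces the term [eps * |g|]. *)
Lemma approximate_multiplier (delta : R) : 0 < delta ->
  exists g, forall a v, E a v -> a - dot g v + eps * `|g| <= alpha + delta.
Proof.
move=> delta0.
have alpha0 : 0 <= alpha.
  apply: (@le_trans _ _ a0); first by case/andP: (E01 Ea0).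
  by apply: Ealpha Ea0 _; rewrite normr0 ltW.
pose F a w := exists v h, [/\ E a v, `|h| <= eps & w = v - h].
pose eta := delta * eps.
have eta0 : 0 < eta by rewrite mulr_gt0.
have [g gP] : exists g, forall a w, F a w -> a - dot g w <= alpha + delta.
  apply: (@penalized_multiplier F 1 _ (eta ^- 2)).
  - by rewrite invr_gt0 exprn_gt0.
  - move=> t a u b v /andP[t0 t1] [u' [h [Eu hle ->]]] [v' [k [Ev kle ->]]].
    exists ((1 - t) *: u' + t *: v'), ((1 - t) *: h + t *: k); split.
    + by apply: Econv => //; rewrite t0.
    + rewrite (le_trans (ler_normD _ _))// !normrZ !ger0_norm ?subr_ge0//.
      have := ler_wpM2l t0 kle.
      have : (1 - t) * `|h| <= (1 - t) * eps by rewrite ler_wpM2l// subr_ge0.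
      lra.
    + by rewrite !scalerBr opprD addrACA.
  - by exists a0, 0, 0, 0; rewrite normr0 subrr ltW.
  - by move=> a w [v [h [/E01/andP[]]]].
  - move=> a w [v [h [Eav hle wE]]]; have /andP[a_ge0 a_le1] := E01 Eav.
    have [wlt|wge] := ltP `|w| eta; last first.
      have : 1 <= eta ^- 2 * `|w| ^+ 2.
        rewrite mulrC ler_pdivlMr ?exprn_gt0// mul1r lerXn2r// nnegrE//.
        exact: ltW.
      lra.
    suff ale : a <= alpha + delta.
      have : 0 <= eta ^- 2 * `|w| ^+ 2.
        by rewrite mulr_ge0 ?sqr_ge0// invr_ge0 exprn_ge0// ltW.
      lra.
    pose t := delta / (1 + delta).
    have d1 : 0 < 1 + delta by rewrite ltr_wpDl.
    have tE : t * (1 + delta) = delta by rewrite /t divfK// gt_eqF.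
    have t0 : 0 <= t by rewrite divr_ge0// ltW.
    have t1 : t <= 1 by rewrite ler_pdivrMr// mul1r lerDr.
    have t01 : 0 <= t <= 1 by rewrite t0.
    have := Ealpha (Econv t01 Eav Ea0).
    rewrite scaler0 addr0 normrZ ger0_norm ?subr_ge0//.
    have vle : `|v| <= eps + eta.
      rewrite (_ : v = h + w); last by rewrite wE addrC subrK.
      by rewrite (le_trans (ler_normD _ _))// lerD// ltW.
    have tvle : (1 - t) * `|v| <= eps.
      have : (1 - t) * `|v| <= (1 - t) * (eps + eta).
        by rewrite ler_wpM2l// subr_ge0.
      suff -> : (1 - t) * (eps + eta) = eps by [].
      have -> : eps + eta = (1 + delta) * eps by rewrite /eta mulrDl mul1r.
      by rewrite mulrA mulrBl tE mul1r addrK mul1r.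
    move=> /(_ tvle) mix; have /andP[a00 _] := E01 Ea0.
    have := mulr_ge0 t0 a00; have := mulr_ge0 t0 (ltW delta0).
    have : t * a <= t by rewrite ler_piMr.
    lra.
(* If [g = 0], then [eps / `|g|] is [0] and [h] is the centre of the ball. *)
exists g => a v Eav.
have := gP a (v - (eps / `|g|) *: g).
rewrite dotBr dotZr -normE expr2 mulrA.
have -> : eps / `|g| * `|g| * `|g| = eps * `|g|.
  have [->|g0] := eqVneq g 0; first by rewrite normr0 !mulr0.
  by rewrite divfK// normr_eq0.
suff Fg : F a (v - (eps / `|g|) *: g) by move=> /(_ Fg); lra.
exists v, ((eps / `|g|) *: g); split => //.
rewrite normrZ ger0_norm ?divr_ge0 ?(ltW eps0)//.
have [->|g0] := eqVneq g 0; first by rewrite normr0 mulr0 ltW.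
by rewrite divfK// normr_eq0.
Qed.

(** The multipliers with error [1 / (n + 1)] form decreasing convex sets, and
    evaluating the inequality at the Slater point [(a0, 0)] bounds their norms
    by [(alpha + 1) / eps]; the inequality passes to the limit. *)
Lemma lagrange_multiplier :
  exists g, forall a v, E a v -> a - dot g v + eps * `|g| <= alpha.
Proof.
pose C n := [set g | forall a v, E a v ->
  a - dot g v + eps * `|g| <= alpha + n.+1%:R^-1].
have [g [l [gC gl]]] : exists (g : nat -> V) (l : V),
    (forall n, C n (g n)) /\ g @ \oo --> l.
  apply: (@cvg_nested_convex _ _ _ normE C ((alpha + 1) / eps)).
  - move=> n p np g Cg a v Eav; rewrite (le_trans (Cg _ _ Eav))//.
    by rewrite lerD2l invSn_anti.
  - move=> n g g' Cg Cg' a v Eav; have := Cg _ _ Eav; have := Cg' _ _ Eav.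
    have : eps * `|2^-1 *: g + 2^-1 *: g'| <=
        eps * (2^-1 * `|g| + 2^-1 * `|g'|).
      rewrite ler_pM2l// (le_trans (ler_normD _ _))// !normrZ ger0_norm//.
    rewrite dotDl !dotZl; move: (n.+1%:R^-1 : R) => en.
    move: (`|_ *: _ + _| : R) (`|g| : R) (`|g'| : R) => x y z.
    lra.
  - move=> n; have n0 : (0 : R) < n.+1%:R^-1 by rewrite invr_gt0.
    have [g gP] := approximate_multiplier n0; exists g => //.
    have := gP _ _ Ea0; rewrite dotC dot0l ler_pdivlMr//.
    have := invSn_le1 R n.
    have /andP[a00 _] := E01 Ea0; rewrite (mulrC eps).
    by move: (n.+1%:R^-1 : R) => en; lra.
exists l => a v Eav.
have lim1 : a - dot (g n) v + eps * `|g n| @[n --> \oo]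
    --> a - dot l v + eps * `|l|.
  apply: cvgD.
    by apply: cvgB; [exact: cvg_cst|exact: (cvg_dot normE)].
  by apply: cvgM; [exact: cvg_cst|exact: cvg_norm].
have lim2 : (alpha + n.+1%:R^-1) @[n --> \oo] --> alpha.
  rewrite -[X in _ --> X]addr0; apply: cvgD; first exact: cvg_cst.
  exact: cvg_harmonic.
by apply: (ler_cvg_to lim1 lim2); apply: nearW => n; exact: gC.
Qed.
End multiplier.
End duality.

(** * Probabilities with a mean embedding *)

Section mixture.
Local Open Scope ereal_scope.
Context d (T : measurableType d) (R : realType) (P Q : probability T R) (t : R).
Hypothesis t01 : (0 <= t <= 1)%R.

Let t_ge0 : (0 <= t)%R. Proof. by case/andP: t01. Qed.
Let onem_ge0 : (0 <= 1 - t)%R. Proof. by rewrite subr_ge0; case/andP: t01. Qed.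

Definition mixture : set T -> \bar R :=
  measure_add (mscale (NngNum onem_ge0) P) (mscale (NngNum t_ge0) Q).

HB.instance Definition _ := Measure.on mixture.

Lemma mixtureE A : mixture A = (1 - t)%:E * P A + t%:E * Q A.
Proof. by rewrite /mixture measure_addE. Qed.

Let mixture_setT : mixture setT = 1.
Proof. by rewrite mixtureE !probability_setT !mule1 -EFinD subrK. Qed.

HB.instance Definition _ :=
  Measure_isProbability.Build _ _ _ mixture mixture_setT.

End mixture.

Section empirical_probability.
Context d (T : measurableType d) (R : realType) (N : nat) (xi : 'I_N -> T).

(** The proof that the sample is nonempty is an argument, so that the instance
    below can recover it. *)
Definition empirical_probability of (0 < N)%N : set T -> \bar R :=
  empirical R xi.

HB.instance Definition _ (N_gt0 : (0 < N)%N) :=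
  Measure.on (empirical_probability N_gt0).
HB.instance Definition _ (N_gt0 : (0 < N)%N) :=
  Measure_isProbability.Build _ _ _ (empirical_probability N_gt0)
    (empirical_setT R xi N_gt0).

End empirical_probability.

Section embedding.
Context d (T : measurableType d) (R : realType) (k : T -> T -> R) (H : rkhs k).

Local Notation dot := (rkhs_dot H).
Local Notation feature := (rkhs_feature H).

Lemma rkhs_dot_inj (u v : H) : (forall h, dot h u = dot h v) -> u = v.
Proof.
move=> uv; apply/eqP; rewrite -subr_eq0 -normr_eq0 -sqrf_eq0 rkhs_normE.
by rewrite dotBr uv subrr.
Qed.

(** The functions of [H] that are measurable form a subspace, closed since
    convergence in [H] implies pointwise convergence; it contains the kernel
    sections, and a function orthogonal to these vanishes everywhere by the
    reproducing property. *)
Lemma measurable_rkhs_eval (h : H) :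
  (forall y, measurable_fun setT (k ^~ y)) ->
  measurable_fun setT (rkhs_eval H h).
Proof.
move=> k_meas; apply: (@closed_subspace_full _ _ _ (@rkhs_normE _ _ _ H)
  [set h : H | measurable_fun setT (rkhs_eval H h)]) => //=.
- suff -> : rkhs_eval H 0 = cst 0 by exact: measurable_cst.
  by apply/funext => x; rewrite rkhs_reproducing dot0l.
- move=> a u v mu mv.
  suff -> : rkhs_eval H (a *: u + v) = (a \*o rkhs_eval H u) \+ rkhs_eval H v.
    by apply: measurable_funD => //; exact: measurable_funM.
  by apply/funext => x /=; rewrite rkhs_eval_linear.
- move=> u l mu ul; apply: (measurable_fun_cvg (fun n => mu n)) => x _.
  rewrite rkhs_reproducing; under eq_fun do rewrite rkhs_reproducing.
  exact: (cvg_dot (@rkhs_normE _ _ _ H)).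
- move=> w worth; apply: (@rkhs_eval_inj _ _ _ H); apply/funext => x.
  rewrite !rkhs_reproducing dot0l; apply: worth => /=.
  suff -> : rkhs_eval H (feature x) = k ^~ x by exact: k_meas.
  apply/funext => y; rewrite rkhs_featureE.
  have kE u v : k u v = dot (feature u) (feature v).
    by rewrite -(rkhs_featureE H) rkhs_reproducing.
  by rewrite !kE dotC.
Qed.

Section integral.
Hypothesis k_meas : forall y, measurable_fun setT (k ^~ y).
Implicit Types mu nu : {measure set T -> \bar R}.

Lemma measurable_dot_feature (h : H) :
  measurable_fun setT (fun t => (dot h (feature t))%:E).
Proof.
apply/measurable_EFinP.
suff -> : (fun t => dot h (feature t)) = rkhs_eval H h.
  exact: measurable_rkhs_eval.
by apply/funext => t; rewrite rkhs_reproducing.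
Qed.

Local Notation embeds mu v := (is_weak_integral mu feature v).

Lemma weak_integral_unique mu (u v : H) : embeds mu u -> embeds mu v -> u = v.
Proof.
by move=> muu muv; apply: rkhs_dot_inj => h; rewrite (muu h).2 (muv h).2.
Qed.

Lemma mean_embeddingE mu (v : H) : embeds mu v -> mean_embedding H mu = v.
Proof.
move=> muv; apply: (weak_integral_unique _ muv).
by rewrite /mean_embedding; case: xgetP => [u -> //|/(_ v)].
Qed.

(** Extended real integrals are the ones that are additive and homogeneous in
    the measure, so the computations below are carried out with them. *)
Lemma weak_integralP mu (v : H) :
  (forall h, mu.-integrable setT (fun t => (dot h (feature t))%:E) /\
     \int[mu]_t (dot h (feature t))%:E = (dot h v)%:E)%E <-> embeds mu v.
Proof.
split=> muv h; have [int_h E] := muv h; split => //.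
  by rewrite /Rintegral E.
by rewrite E /Rintegral fineK//; exact: integrable_fin_num.
Qed.

Lemma weak_integral_eq mu nu (v : H) :
  (forall A, measurable A -> mu A = nu A) -> embeds mu v -> embeds nu v.
Proof.
move=> munu /weak_integralP muv; apply/weak_integralP => h.
have [int_h E] := muv h.
have intE (f : T -> \bar R) : (\int[nu]_t f t = \int[mu]_t f t)%E.
  by apply: eq_measure_integral => A mA _; rewrite munu.
split; last by rewrite intE.
case/integrableP : int_h => mh fin_h; apply/integrableP; split => //.
by rewrite intE.
Qed.

Lemma weak_integral_dirac (t : T) : embeds (dirac t) (feature t).
Proof.
apply/weak_integralP => h.
have mh := measurable_dot_feature h.
split; last by rewrite integral_dirac// diracT mul1e.
apply/integrableP; split => //; rewrite integral_dirac// ?diracT ?mul1e ?ltry//.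
exact: measurableT_comp.
Qed.

Lemma weak_integral_zero : embeds mzero 0.
Proof.
apply/weak_integralP => h.
have mh := measurable_dot_feature h.
split; last by rewrite integral_measure_zero dotC dot0l.
by apply/integrableP; split => //; rewrite integral_measure_zero ltry.
Qed.

Lemma weak_integral_add mu nu (u v : H) :
  embeds mu u -> embeds nu v -> embeds (measure_add mu nu) (u + v).
Proof.
move=> /weak_integralP muu /weak_integralP nuv; apply/weak_integralP => h.
have [iu Eu] := muu h; have [iv Ev] := nuv h.
have mh := measurable_dot_feature h.
split; last by rewrite integral_measure_add// Eu Ev dotDr.
apply/integrableP; split => //; rewrite ge0_integral_measure_add//.
  by apply: lte_add_pinfty; [case/integrableP : iu|case/integrableP : iv].
exact: measurableT_comp.
Qed.

Lemma weak_integral_scale mu (a : {nonneg R}) (v : H) :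
  embeds mu v -> embeds (mscale a mu) (a%:num *: v).
Proof.
move=> /weak_integralP muv; apply/weak_integralP => h.
have [iv Ev] := muv h.
have mh := measurable_dot_feature h.
have mn : measurable_fun setT (fun t => `|(dot h (feature t))%:E|)%E.
  exact: measurableT_comp.
have ia : (mscale a mu).-integrable setT (fun t => (dot h (feature t))%:E).
  apply/integrableP; split => //; rewrite ge0_integral_mscale//.
  by case/integrableP : iv => _ fin; rewrite lte_mul_pinfty.
split => //; rewrite integralE !ge0_integral_mscale//.
- rewrite -muleBr//; first by rewrite -integralE Ev dotZr.
  exact: integrable_add_def.
- exact: measurable_funeneg.
- exact: measurable_funepos.
Qed.

Lemma weak_integral_msum (m : {measure set T -> \bar R}^nat) (v : nat -> H) n :
  (forall i, embeds (m i) (v i)) -> embeds (msum m n) (\sum_(i < n) v i).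
Proof.
move=> mv; elim: n => [|n IH].
  rewrite big_ord0; apply: weak_integral_eq weak_integral_zero => A _.
  by rewrite /= /msum big_ord0.
rewrite big_ord_recr; apply: weak_integral_eq (weak_integral_add IH (mv n)).
by move=> A _; rewrite [LHS]measure_addE /= /msum big_ord_recr.
Qed.

Lemma weak_integral_empirical N (xi : 'I_N -> T) :
  embeds (empirical R xi) (N%:R^-1 *: \sum_(i < N) feature (xi i)).
Proof.
pose m (i : nat) : {measure set T -> \bar R} :=
  if insub i is Some j then dirac (xi j) else mzero.
pose v (i : nat) : H := if insub i is Some j then feature (xi j) else 0.
have mv i : embeds (m i) (v i).
  rewrite /m /v; case: insubP => [j _ _|_]; first exact: weak_integral_dirac.
  exact: weak_integral_zero.
have NE : (0 <= N%:R^-1 :> R)%R by rewrite invr_ge0 ler0n.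
have -> : \sum_(i < N) feature (xi i) = \sum_(i < N) v i.
  by apply: eq_bigr => i _; rewrite /v valK.
have := weak_integral_scale (NngNum NE) (weak_integral_msum N mv).
apply: weak_integral_eq => A _.
rewrite /mscale /= /empirical /msum; congr (_ * _)%E.
by apply: eq_bigr => i _; rewrite /m valK.
Qed.

Lemma weak_integral_mixture (P Q : probability T R) (t : R) (t01 : 0 <= t <= 1)
    (u v : H) :
  embeds P u -> embeds Q v -> embeds (mixture P Q t01) ((1 - t) *: u + t *: v).
Proof.
move=> Pu Qv.
exact: weak_integral_add (weak_integral_scale _ Pu) (weak_integral_scale _ Qv).
Qed.

End integral.
End embedding.

(** * Duality for the chance constraint *)

Section chance_constraint.
Context d (T : measurableType d) (R : realType) (k : T -> T -> R).
Hypothesis k_meas : forall y, measurable_fun setT (k ^~ y).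
Context (H : rkhs k) (f : T -> R).
Hypothesis f_meas : measurable_fun setT f.

Local Notation dot := (rkhs_dot H).
Local Notation embeds mu v := (is_weak_integral mu (rkhs_feature H) v).
Local Notation violation := [set t | (0 < f t)%R].

Lemma measurable_violation : measurable violation.
Proof.
rewrite (_ : violation = f @^-1` `]0, +oo[%classic).
  by rewrite -[X in measurable X]setTI; exact: f_meas.
by apply/seteqP; split => t /=; rewrite in_itv/= andbT.
Qed.

Lemma satisfaction_ge (P : probability T R) (alpha : R) :
  ((1 - alpha)%:E <= P [set t | (f t <= 0)%R])%E = (P violation <= alpha%:E)%E.
Proof.
have -> : [set t | f t <= 0] = ~` violation.
  by apply/seteqP; split => t /=; rewrite leNgt => /negP.
rewrite probability_setC; last exact: measurable_violation.
have /fineK <- : P violation \is a fin_num.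
  by apply: fin_num_measure; exact: measurable_violation.
by rewrite -EFinB !lee_fin lerD2l lerN2.
Qed.

Lemma violation_le_majorant (P : probability T R) (v g : H) (g0 : R) :
    embeds P v -> (forall t, (0 < f t)%R%:R <= rkhs_eval H g t + g0) ->
  (P violation <= (dot g v + g0)%:E)%E.
Proof.
move=> /weak_integralP Pv gP; have [int_g E] := Pv g.
have -> : P violation = (\int[P]_t (\1_violation t)%:E)%E.
  by rewrite integral_indic// ?setIT//; exact: measurable_violation.
have -> : ((dot g v + g0)%:E =
    \int[P]_t ((dot g (rkhs_feature H t))%:E + g0%:E))%E.
  rewrite integralD//; last exact: finite_measure_integrable_cst.
  have cstE : (\int[P]__ g0%:E = g0%:E)%E.
    apply: etrans (integral_cst P measurableT g0%:E) _.
    by rewrite -[RHS]mule1; congr (_ * _)%E; exact: probability_setT.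
  by rewrite E [X in (_ + X)%E]cstE.
apply: ge0_le_integral => //.
- apply/measurable_EFinP; exact: measurable_indic measurable_violation.
- apply: emeasurable_funD; last exact: measurable_cst.
  by case/integrableP : int_g.
- move=> t _; rewrite -EFinD lee_fin -rkhs_reproducing.
  by apply: le_trans (gP t); rewrite indicE mem_setE.
Qed.

(** The result for one decision, over an arbitrary measurable space. *)
Theorem chance_constraint_duality (N : nat) (N_gt0 : (0 < N)%N) (xi : 'I_N -> T)
    (alpha eps : R) (eps_gt0 : 0 < eps) :
  ((1 - alpha)%:E <=
     ereal_inf [set P [set t | (f t <= 0)%R]
               | P in ambiguity_set H (empirical R xi) eps])%E <->
  exists (g : H) (g0 : R),
    g0 + N%:R^-1 * \sum_(i < N) rkhs_eval H g (xi i) + eps * `|g| <= alpha /\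
    forall t, (0 < f t)%R%:R <= rkhs_eval H g t + g0.
Proof.
have emb := @weak_integral_empirical _ _ _ _ H k_meas _ xi.
set m := _ *: _ in emb.
have gm g : N%:R^-1 * \sum_(i < N) rkhs_eval H g (xi i) = dot g m.
  rewrite dotZr dot_sumr; congr (_ * _); apply: eq_bigr => i _.
  by rewrite rkhs_reproducing.
have norm2 := @rkhs_normE _ _ _ H.
split=> [robust|[g [g0 [gle gP]]]]; last first.
  apply: le_ereal_inf_tmp => _ [P [[v Pv] Peps] <-]; rewrite satisfaction_ge.
  apply: (le_trans (violation_le_majorant Pv gP)); rewrite lee_fin.
  move: Peps; rewrite /mmd (mean_embeddingE Pv) (mean_embeddingE emb) => veps.
  apply: le_trans gle; rewrite gm.
  have := cauchy_schwarz norm2 g (v - m); rewrite dotBr.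
  have : `|g| * `|v - m| <= eps * `|g| by rewrite mulrC ler_wpM2r.
  by move: (`|g| * `|v - m| : R) => x; lra.
pose E a v := exists (P : probability T R) (u : H),
  [/\ P violation = a%:E, embeds P u & v = u - m].
have Econv : convex_rel E.
  move=> t a u b v t01 [P [u' [Pa Pu ->]]] [Q [v' [Qb Qv ->]]].
  exists (mixture P Q t01), ((1 - t) *: u' + t *: v'); split.
  - by rewrite [LHS]mixtureE Pa Qb.
  - exact: weak_integral_mixture.
  - by rewrite !scalerBr addrACA -opprD -scalerDl subrK scale1r.
have E01 a v : E a v -> 0 <= a <= 1.
  move=> [P [u [Pa _ _]]]; rewrite -!lee_fin -Pa measure_ge0/=.
  exact: probability_le1 measurable_violation.
pose Pemp : probability T R := empirical_probability R xi N_gt0.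
have Pfin (P : probability T R) : P violation = (fine (P violation))%:E.
  by rewrite fineK//; apply: fin_num_measure; exact: measurable_violation.
have Eemp : E (fine (Pemp violation)) 0.
  by exists Pemp, m; split; [exact: Pfin|exact: emb|rewrite subrr].
have Ealpha a v : E a v -> `|v| <= eps -> a <= alpha.
  move=> [P [u [Pa Pu ->]]] ueps; rewrite -lee_fin -Pa -satisfaction_ge.
  apply: (le_trans robust); apply: ereal_inf_lbound; exists P => //; split.
    by exists u.
  by rewrite /mmd (mean_embeddingE Pu) (mean_embeddingE emb).
have [g gE] := lagrange_multiplier norm2 eps_gt0 Econv E01 Eemp Ealpha.
exists g, (alpha - dot g m - eps * `|g|); split; first by rewrite gm; lra.
move=> t; rewrite rkhs_reproducing.
have /gE : E (0 < f t)%R%:R (rkhs_feature H t - m).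
  exists (dirac t), (rkhs_feature H t).
  split => //; last exact: weak_integral_dirac.
  by apply: etrans (diracE R t _) _; rewrite mem_setE.
by rewrite dotBr; lra.
Qed.

End chance_constraint.

Unset Implicit Arguments.

Theorem proposition2p1 (R : realType) (n m : nat)
    (X : set 'rV[R]_n) (Xi : set 'rV[R]_m) (xi0 : Xi)
    (k : borel_sub xi0 -> borel_sub xi0 -> R) (k_psd : psd_kernel k)
    (k_meas : forall y, measurable_fun setT (fun t => k t y))
    (H : rkhs k)
    (f : X -> borel_sub xi0 -> R)
    (f_meas : forall x, measurable_fun setT (f x))
    (N : nat) (N_gt0 : (0 < N)%N) (xi : 'I_N -> borel_sub xi0)
    (alpha eps : R) (alpha_ge0 : 0 <= alpha) (eps_gt0 : 0 < eps) :
  [set x : X |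
    ((1 - alpha)%:E <=
     ereal_inf [set P [set t | (f x t <= 0)%R]
               | P in ambiguity_set H (empirical R xi) eps])%E] =
  [set x : X | exists (g : H) (g0 : R),
    g0 + N%:R^-1 * \sum_(i < N) rkhs_eval H g (xi i) + eps * `|g| <= alpha /\
    forall t, (0 < f x t)%R%:R <= rkhs_eval H g t + g0].
Proof.
have dual x :=
  chance_constraint_duality k_meas H (f_meas x) N_gt0 xi alpha eps_gt0.
by apply/seteqP; split => x /=; case: (dual x).
Qed.
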